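(* Let $(x_n)_{n \in \mathbb{N}}$ be a sequence in $[0,1)$, and suppose that there exist $0 < \alpha \le 1$ and a function $F : \mathbb{N} \times \mathbb{N} \to \mathbb{R}$ which is monotonically increasing in its first argument and which satisfies $$\max_{s=1,\ldots,K} \left| \frac{1}{2s}\, \#\left\{1 \le l \ne m \le N : \|x_l - x_m\| < \frac{s}{N^\alpha}\right\} - N^{2-\alpha} \right| < F(K,N)$$ for all $N \in \mathbb{N}$ and all $K \in \mathbb{N}$ with $K \le N/2$ (here $s$ runs over integers). Then there exists an integer $N_0 > 0$ such that for all $N \in \mathbb{N}$ with $N \ge N_0$ and all $K \in \mathbb{N}$ satisfying $$\tfrac{1}{2} N^{\frac{2}{5}\alpha} \le K \le N^{\frac{2}{5}\alpha}$$ we have $$N D_N^*(x_n) \le 5 \max\left( N^{1-\frac{1}{5}\alpha}, \sqrt{N^\alpha \cdot F(K^2,N)} \right).$$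
   Context: $\|\cdot\|$ denotes the distance to the nearest integer; the pairs $(l,m)$ are ordered. The star-discrepancy of the first $N$ terms of a sequence in $[0,1)$ is $$D_N^*(x_n) := \sup_{[0,b) \subset [0,1)} \left| \tfrac{1}{N}\#\{1\le i\le N : x_i \in [0,b)\} - b \right|.$$ *)

(* Defs.v *)
From HB Require Import structures.
From mathcomp Require Import all_boot all_order all_algebra.
From mathcomp Require Import all_classical all_reals all_analysis.

Set Implicit Arguments.
Unset Strict Implicit.
Unset Printing Implicit Defensive.

Import Order.TTheory GRing.Theory Num.Theory.
Local Open Scope classical_set_scope.
Local Open Scope ring_scope.

(* Sequences are indexed from 1: the first N terms of x are x 1, ..., x N,
   and x 0 is never used.  In the counts below, i : 'I_N stands for the
   index i.+1. *)

Definition dist_int (R : realType) (y : R) : R :=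
  inf [set `|y - n%:~R| | n in [set: int]].

Definition count_lt (R : realType) (x : nat -> R) (N : nat) (b : R) : nat :=
  #|[pred i : 'I_N | x i.+1 \in `[0, b[]|.

(* The supremum is over 0 <= b <= 1 only: for b < 0 the interval [0, b) is
   empty, hence trivially contained in [0, 1), but is not an admissible one. *)
Definition star_discrepancy (R : realType) (x : nat -> R) (N : nat) : R :=
  sup [set `|N%:R^-1 * (count_lt x N b)%:R - b| | b in [set b : R | 0 <= b <= 1]].

Definition close_pairs (R : realType) (x : nat -> R) (N : nat) (r : R) : nat :=
  #|[pred p : 'I_N * 'I_N |
      (p.1 != p.2) && (dist_int (x p.1.+1 - x p.2.+1) < r)]|.

(* For K >= 1 the default value 0 of the maximum is harmless, since all the
   terms are nonnegative. *)
Definition max_pair_deviation (R : realType) (x : nat -> R) (alpha : R)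
    (K N : nat) : R :=
  \big[Num.max/0]_(1 <= s < K.+1)
    `|(2 * s%:R)^-1 * (close_pairs x N (s%:R / N%:R `^ alpha))%:R
      - N%:R `^ (2 - alpha)|.

(* Main.v *)
Require Import Defs.
From HB Require Import structures.
From mathcomp Require Import all_boot all_order all_algebra.
From mathcomp Require Import all_classical all_reals all_analysis.
From mathcomp Require Import ring lra zify.

Set Implicit Arguments.
Unset Strict Implicit.
Unset Printing Implicit Defensive.

Import Order.TTheory GRing.Theory Num.Theory.
Local Open Scope classical_set_scope.
Local Open Scope ring_scope.

(** Cut the circle R/Z into P = p + 1 equal cells with P the least integer
above M = N^alpha, and count the points in each of the P cyclic windows of
S = K^2 consecutive cells.  The counts add up to N S
([sum_occupancy]).  The sum of their squares counts pairs of points weighted by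
the number of windows they share; two points sharing a window are close on the
circle, and the sum is at most N S plus the sum over s = 1, ..., S of the number
of ordered pairs at distance less than s / M ([sum_occupancy_sqr_le],
[dist_int_lt_of_offsets]).  The pair correlation hypothesis bounds that by
S (S + 1) (N^2 / M + F(S, N)).  The main term nearly equals
(N S)^2 / P, so what is left is a bound for the variance, the sum of the squared
deviations of the window counts from their mean N S / P.

A window contained in an interval only sees the points of that interval.  Hence,
by Cauchy-Schwarz over the windows inside an interval, the number of its points
falls short of the expected number by at most the number N S / P expected in one
window, plus (1 / S) sqrt (P * variance) ([card_cells_itv_ge]).
Applied to [0, b) and to [b, 1), this bounds the deviation of the count in [0, b)
from both sides ([count_lt_deviation_le]).

With a = N^(alpha / 5) one has M = a^5 and a^4 / 4 <= S <= a^4.  Let Z be the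
maximum in the conclusion, so that Z >= N / a and Z^2 >= M F(S, N).  The window
term is N S / P <= N / a <= Z, and the other one is at most 4 Z as soon as a >= 2
([variance_numerics]); the total is 5 Z.  The condition a >= 2 is what determines
N0. *)

(** * Cyclic windows of cells *)

(** The number of points in the window of cells j, j + 1, ..., j + S - 1: the
subtraction is modulo p + 1, so that windows wrap around. *)
Definition occupancy (p S : nat) (I : finType) (c : I -> 'I_p.+1)
    (j : 'I_p.+1) : nat :=
  (\sum_(i : I) ((c i - j)%R < S))%N.

(** The reflection j |-> c - j turns the windows containing c into the windows
starting at one of the cells 0, ..., S - 1. *)
Lemma sum_windows_of_cell (p S : nat) (c : 'I_p.+1) : (S <= p.+1)%N ->
  (\sum_(j : 'I_p.+1) ((c - j)%R < S) = S)%N.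
Proof.
move=> leSp; rewrite (reindex_inj (h := fun j => c - j)); last first.
  by move=> j k /addrI /oppr_inj.
under eq_bigr do rewrite [(c - (c - _))%R]subKr.
rewrite -(big_mkord xpredT (fun j => nat_of_bool (j < S)%N)).
rewrite (@big_cat_nat _ _ _ S) //= [X in (_ + X)%N]big1_seq ?addn0; last first.
  by move=> j; rewrite mem_index_iota /= leqNgt => /andP[/negbTE->].
rewrite (eq_big_nat _ _ (F2 := fun=> 1%N)) => [|j /andP[_ ->] //].
by rewrite sum_nat_const_nat subn0 muln1.
Qed.

Lemma sum_occupancy (p S : nat) (I : finType) (c : I -> 'I_p.+1) :
  (S <= p.+1)%N -> (\sum_j occupancy S c j = #|I| * S)%N.
Proof.
move=> leSp; rewrite exchange_big /=.
by under eq_bigr do rewrite sum_windows_of_cell //; rewrite sum_nat_const.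
Qed.

Lemma ord_addE_small (p : nat) (u v : 'I_p.+1) :
  (u + v < p.+1)%N -> (u + v)%R = (u + v)%N :> nat.
Proof. exact: modn_small. Qed.

(** A window shared by two cells is determined by the larger of the two offsets.
The length condition rules out windows that reach from c to c' both ways around
the circle. *)
Lemma max_offset_inj (p S : nat) (c c' : 'I_p.+1) : (2 * S <= p.+1)%N ->
  {in [pred j : 'I_p.+1 | ((c - j)%R < S) && ((c' - j)%R < S)]%N &,
    injective (fun j : 'I_p.+1 => maxn (c - j)%R (c' - j)%R)}.
Proof.
(* If d attains the maximum m for j and d' attains it for k, then with t = k - j
   the residues of m + t and m - t are at most m and sum to 2 m modulo p + 1; as
   2 m < p + 1 there is no wrap-around, so both are m and t = 0. *)
have twist (d d' j k : 'I_p.+1) : (2 * S <= p.+1)%N -> ((d - j)%R < S)%N ->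
    (d - j)%R = (d' - k)%R -> ((d' - j)%R <= (d - j)%R)%N ->
    ((d - k)%R <= (d' - k)%R)%N -> j = k.
  move=> leSp dS eqm le1 le2.
  have eq2 : (d' - j) + (d - k) = (d - j) + (d - j).
    by rewrite {2}eqm addrACA [RHS]addrACA (addrC d').
  rewrite -eqm in le2; move: eq2 => /(congr1 (@nat_of_ord p.+1)).
  rewrite (ord_addE_small (u := d' - j)) ?(ord_addE_small (u := d - j));
    [move=> eq2 | lia..].
  have /val_inj : val (d' - j) = val (d - j) by move: eq2 le1 le2 => /=; lia.
  rewrite eqm => /addrI /oppr_inj //.
move=> leSp j k; rewrite !inE => /andP[cj c'j] /andP[ck c'k].
have same (d : 'I_p.+1) : val (d - j) = val (d - k) -> j = k.
  by move=> /val_inj /addrI /oppr_inj.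
case: (leqP (c - j)%R (c' - j)%R) => h1;
  case: (leqP (c - k)%R (c' - k)%R) => h2 e.
- exact: same e.
- by apply: (twist c' c) => //; [apply: val_inj | exact: ltnW].
- by apply: (twist c c') => //; [apply: val_inj | exact: ltnW].
- exact: same e.
Qed.

(** Sending a common window to its larger offset m < S injects the common windows
into the m satisfying D.  This gives the weight that integrating the number
of pairs over the distance would give: a pair at scale s shares about S - s
windows. *)
Lemma sum_common_windows_le (p S : nat) (c c' : 'I_p.+1) (D : pred nat) :
    (2 * S <= p.+1)%N ->
    (forall j : 'I_p.+1, ((c - j)%R < S)%N -> ((c' - j)%R < S)%N ->
      D (maxn (c - j)%R (c' - j)%R)) ->
  (\sum_(j : 'I_p.+1) ((c - j)%R < S) * ((c' - j)%R < S)
     <= \sum_(m < S) D m)%N.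
Proof.
move=> leSp HD.
have cardE (T : finType) (A : pred T) : (\sum_(t : T) A t = #|A|)%N.
  by rewrite -sum1_card [RHS]big_mkcond.
under eq_bigr do rewrite mulnb.
rewrite (cardE _ [pred j : 'I_p.+1 | ((c - j)%R < S) && ((c' - j)%R < S)]%N).
rewrite (cardE _ [pred m : 'I_S | D m]).
case: S leSp HD => [|S] leSp HD; first by rewrite eq_card0.
set A := [pred j : 'I_p.+1 | _].
pose f (j : 'I_p.+1) : 'I_S.+1 := inord (maxn (c - j)%R (c' - j)%R).
have fE j : j \in A -> val (f j) = maxn (c - j)%R (c' - j)%R.
  by rewrite inE => /andP[h1 h2]; apply: inordK; rewrite gtn_max h1.
rewrite -(card_in_image (f := f) (A := A)).
  apply/subset_leq_card/fintype.subsetP => _ /fintype.imageP[j Aj ->].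
  rewrite !inE fE //; move: Aj; rewrite inE => /andP[]; exact: HD.
move=> j k Aj Ak /(congr1 val).
by rewrite !fE // => /(max_offset_inj leSp Aj Ak).
Qed.

(** Second moment of the window counts.  Expanding the squares gives a sum over
ordered pairs of the number of common windows; the diagonal contributes |I| S. *)
Lemma sum_occupancy_sqr_le (p S : nat) (I : finType) (c : I -> 'I_p.+1)
    (D : I -> I -> pred nat) : (2 * S <= p.+1)%N ->
    (forall i i' (j : 'I_p.+1), i != i' -> ((c i - j)%R < S)%N ->
      ((c i' - j)%R < S)%N -> D i i' (maxn (c i - j)%R (c i' - j)%R)) ->
  (\sum_j occupancy S c j ^ 2 <= #|I| * S +
    \sum_(m < S) #|[pred q : I * I | (q.1 != q.2) && D q.1 q.2 m]|)%N.
Proof.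
move=> leSp HD.
have -> : (\sum_j occupancy S c j ^ 2 =
    \sum_i \sum_i' \sum_(j : 'I_p.+1) ((c i - j)%R < S) * ((c i' - j)%R < S))%N.
  rewrite [RHS](eq_bigr (fun i => \sum_j \sum_i'
    ((c i - j)%R < S) * ((c i' - j)%R < S))%N); last first.
    by move=> i _; rewrite exchange_big.
  rewrite exchange_big; apply: eq_bigr => j _.
  rewrite -mulnn {1}/occupancy big_distrl; apply: eq_bigr => i _.
  by rewrite /= /occupancy big_distrr.
have -> : (\sum_(m < S) #|[pred q : I * I | (q.1 != q.2) && D q.1 q.2 m]| =
    \sum_i \sum_i' \sum_(m < S) ((i != i') && D i i' m))%N.
  rewrite pair_big exchange_big /=; apply: eq_bigr => m _.
  by rewrite -sum1_card big_mkcond.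
rewrite -sum_nat_const -big_split; apply: leq_sum => i _ /=.
rewrite (bigD1 i) //= [X in (_ <= _ + X)%N](bigD1 i) //= addnA.
apply: leq_add.
  apply: leq_trans (leq_addr _ _).
  under eq_bigr do rewrite mulnb andbb.
  by rewrite sum_windows_of_cell //; lia.
apply: leq_sum => i'; rewrite eq_sym => ne.
apply: (sum_common_windows_le
  (D := fun m => (i != i') && D i i' m)) => //= j h h'.
by rewrite ne; apply: HD.
Qed.

(** Windows contained in [a, e) contain only cells of [a, e), and each cell lies in
at most S of them. *)
Lemma sum_occupancy_itv_le (p S a e : nat) (I : finType) (c : I -> 'I_p.+1) :
  (e <= p.+1)%N ->
  (\sum_(j : 'I_p.+1 | (a <= j) && (j + S <= e)) occupancy S c j
     <= S * #|[pred i | (a <= c i < e)%N]|)%N.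
Proof.
move=> lee; rewrite exchange_big /= -sum1_card big_distrr.
rewrite [X in (_ <= X)%N]big_mkcond.
apply: leq_sum => i _ /=.
have inW (j : 'I_p.+1) : (a <= j)%N && (j + S <= e)%N ->
    ((c i - j)%R < S)%N -> (a <= c i < e)%N.
  move=> /andP[aj jS] cj.
  have -> : nat_of_ord (c i) = (j + (c i - j)%R)%N.
    rewrite -[in LHS](subrK j (c i)) addrC (ord_addE_small (u := j)) //.
    by apply: leq_trans lee; apply: leq_trans jS; rewrite ltn_add2l.
  rewrite (leq_trans aj) ?leq_addr //=.
  by apply: leq_trans jS; rewrite ltn_add2l.
case: ifP => Hc; last first.
  rewrite big1 // => j Tj; case: ltnP => // /(inW _ Tj).
  by move: Hc; rewrite inE => ->.
rewrite muln1.
have [leSp|/ltnW ltpS] := leqP S p.+1; last first.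
  apply: leq_trans ltpS; rewrite -[X in (_ <= X)%N]card_ord -sum1_card.
  by rewrite big_mkcond; apply: leq_sum => j _; case: ifP => // _; case: ltnP.
rewrite -[X in (_ <= X)%N](sum_windows_of_cell (c i) leSp) big_mkcond.
by apply: leq_sum => j _; case: ifP.
Qed.

(** * From the variance of the window counts to counts in intervals *)

(** Cauchy-Schwarz against the indicator of T, in the form 2 u v <= u^2 + v^2
summed over all pairs of indices. *)
Lemma sqr_sum_le (R : realFieldType) (I : finType) (T : pred I) (u : I -> R) :
  (\sum_(i | T i) u i) ^+ 2 <= #|I|%:R * \sum_i u i ^+ 2.
Proof.
pose v i := if T i then u i else 0.
have -> : \sum_(i | T i) u i = \sum_i v i by rewrite big_mkcond.
apply: (@le_trans _ _ (#|I|%:R * \sum_i v i ^+ 2)); last first.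
  rewrite ler_wpM2l //; apply: ler_sum => i _; rewrite /v.
  by case: ifP => // _; rewrite expr0n sqr_ge0.
rewrite expr2 big_distrlr /=.
apply: (@le_trans _ _ (\sum_i \sum_j (v i ^+ 2 + v j ^+ 2) / 2)).
  apply: ler_sum => i _; apply: ler_sum => j _.
  have := sqr_ge0 (v i - v j); lra.
have sum_cst (z : R) : \sum_(i : I) z = #|I|%:R * z.
  have cardI : #|(xpredT : pred I)| = #|I| by exact: eq_card.
  by rewrite sumr_const cardI mulr_natl.
rewrite (eq_bigr (fun i => (#|I|%:R * v i ^+ 2 + \sum_j v j ^+ 2) / 2)).
  by rewrite -mulr_suml big_split /= -mulr_sumr sum_cst; lra.
by move=> i _; rewrite -mulr_suml big_split /= sum_cst.
Qed.

Lemma occupancy_variance (R : realFieldType) (p S : nat) (I : finType)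
    (c : I -> 'I_p.+1) : (S <= p.+1)%N ->
  \sum_j ((occupancy S c j)%:R - (#|I| * S)%:R / p.+1%:R) ^+ 2 =
    (\sum_j occupancy S c j ^ 2)%:R - (#|I| * S)%:R ^+ 2 / p.+1%:R :> R.
Proof.
move=> leSp; have := sum_occupancy c leSp; set NS := (#|I| * S)%N => sumE.
set mu := NS%:R / p.+1%:R : R.
rewrite (eq_bigr (fun j => (occupancy S c j ^ 2)%:R -
  2 * mu * (occupancy S c j)%:R + mu ^+ 2)); last first.
  by move=> j _; rewrite natrX; ring.
rewrite !big_split /= sumrN -mulr_sumr -!natr_sum sumE.
rewrite sumr_const card_ord -[_ *+ _]mulr_natl /mu; field.
by rewrite addrC natr1 pnatr_eq0.
Qed.

Lemma card_windows_in_itv (p S a e : nat) : (e <= p.+1)%N -> (0 < S)%N ->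
  (e + 1 <= a + S + #|[pred j : 'I_p.+1 | (a <= j) && (j + S <= e)]|)%N.
Proof.
move=> lee S0; rewrite -leq_subLR -[X in (X <= _)%N]card_ord.
set n := (_ - _)%N.
pose f (k : 'I_n) : 'I_p.+1 := inord (a + k).
have fE k : f k = (a + k)%N :> nat.
  by apply: inordK; have := ltn_ord k; rewrite /n; lia.
rewrite -(card_in_image (f := f) (A := 'I_n)).
  apply/subset_leq_card/fintype.subsetP => _ /fintype.imageP[k _ ->]; rewrite !inE fE.
  by have := ltn_ord k; rewrite /n; lia.
move=> k l _ _ /(congr1 (@nat_of_ord p.+1)); rewrite !fE => /addnI.
exact: val_inj.
Qed.

(** By Cauchy-Schwarz, the windows inside [a, e) contain on average nearly the mean
number of points.  There are at least e + 1 - a - S such windows; if this number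
is not positive, the bound is trivially true.  Only a lower bound is proved:
the upper bound for an interval is the lower bound for its complement. *)
Lemma card_cells_itv_ge (R : realFieldType) (p S a e : nat) (I : finType)
    (c : I -> 'I_p.+1) (B : R) :
    (0 < S <= p.+1)%N -> (e <= p.+1)%N -> 0 <= B ->
    p.+1%:R * \sum_j ((occupancy S c j)%:R - (#|I| * S)%:R / p.+1%:R) ^+ 2
      <= (S%:R * B) ^+ 2 ->
  (e%:R + 1 - a%:R - S%:R) * (#|I|%:R / p.+1%:R) - B
    <= #|[pred i | (a <= c i < e)%N]|%:R.
Proof.
move=> /andP[S0 leSp] lee B0 Hvar.
set T := [pred j : 'I_p.+1 | (a <= j) && (j + S <= e)]%N.
set mu : R := (#|I| * S)%:R / p.+1%:R in Hvar.
have SR : 0 < S%:R :> R by rewrite ltr0n.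
have devT : - (S%:R * B) <= \sum_(j | T j) ((occupancy S c j)%:R - mu).
  have SB : 0 <= S%:R * B by rewrite mulr_ge0 // ltW.
  rewrite lerNl.
  have [neg|pos] := leP (\sum_(j | T j) ((occupancy S c j)%:R - mu)) 0; last lra.
  rewrite -ler_sqr ?nnegrE ?oppr_ge0 // sqrrN.
  by apply: le_trans (sqr_sum_le _ _) _; rewrite card_ord.
have occT : \sum_(j | T j) (occupancy S c j)%:R
    <= S%:R * #|[pred i | (a <= c i < e)%N]|%:R :> R.
  by rewrite -natr_sum -natrM ler_nat; exact: sum_occupancy_itv_le.
have cardT : (e%:R + 1 - a%:R - S%:R) * mu <= #|T|%:R * mu.
  rewrite ler_wpM2r ?divr_ge0 //.
  have := card_windows_in_itv a lee S0.
  by rewrite -(ler_nat R) !natrD -/T; lra.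
have sumT : \sum_(j | T j) mu = #|T|%:R * mu.
  by rewrite -sum1_card natr_sum mulr_suml; apply: eq_big => j; rewrite ?mul1r.
rewrite big_split sumrN sumT /= in devT.
rewrite -(ler_pM2l SR).
have -> : S%:R * ((e%:R + 1 - a%:R - S%:R) * (#|I|%:R / p.+1%:R) - B) =
    (e%:R + 1 - a%:R - S%:R) * mu - S%:R * B.
  by rewrite /mu natrM; field; rewrite addrC natr1 pnatr_eq0.
lra.
Qed.

Lemma dist_int_lt (R : realType) (y r : R) (n : int) :
  `|y - n%:~R| < r -> dist_int y < r.
Proof.
apply: le_lt_trans; apply: ge_inf; last by exists n.
by exists 0 => _ [k _ <-].
Qed.

(** * Points of the unit interval and their cells *)

Definition cell (R : realType) (p : nat) (y : R) : 'I_p.+1 :=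
  inord (Num.trunc (p.+1%:R * y)).

Lemma cell_itv (R : realType) (p : nat) (y : R) : 0 <= y < 1 ->
  (cell p y)%:R <= p.+1%:R * y < (cell p y)%:R + 1.
Proof.
move=> /andP[y0 y1]; have py0 : 0 <= p.+1%:R * y by rewrite mulr_ge0.
have := truncn_itv py0; rewrite natr1 /cell inordK //.
by rewrite truncn_lt_nat // gtr_pMr // ltr0n.
Qed.

(** Unwrapping both cells along the window starting at j exhibits an integer n for
which P (y - z - n) is less than 1 away from the difference of the offsets, hence
less than 1 plus the larger offset in absolute value. *)
Lemma dist_int_lt_of_offsets (R : realType) (p : nat) (y z : R) (j : 'I_p.+1) :
    0 <= y < 1 -> 0 <= z < 1 ->
  dist_int (y - z) < (maxn (cell p y - j)%R (cell p z - j)%R).+1%:R / p.+1%:R.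
Proof.
move=> /(cell_itv p)/andP[y1 y2] /(cell_itv p)/andP[z1 z2].
have unwrap (d : 'I_p.+1) : exists u : nat,
    d%:R = j%:R + (d - j)%R%:R - u%:R * p.+1%:R :> R.
  have dE : d = ((j + (d - j)%R) %% p.+1)%N :> nat.
    by rewrite -[in LHS](subrK j d) addrC.
  exists ((j + (d - j)%R) %/ p.+1)%N.
  have := divn_eq (j + (d - j)%R) p.+1; rewrite -dE.
  by move=> /(congr1 (GRing.natmul (1 : R))); rewrite !natrD natrM; lra.
have [u yE] := unwrap (cell p y); have [v zE] := unwrap (cell p z).
move: yE zE y1 y2 z1 z2.
move: (cell p y - j)%R (cell p z - j)%R => d e -> -> y1 y2 z1 z2.
have P0 : 0 < p.+1%:R :> R by rewrite ltr0n.
apply: (@dist_int_lt _ _ _ (v%:Z - u%:Z)).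
rewrite ltr_pdivlMr // -(gtr0_norm P0) -normrM intrB -!pmulrn.
have dm : d%:R <= (maxn d e)%:R :> R by rewrite ler_nat leq_maxl.
have em : e%:R <= (maxn d e)%:R :> R by rewrite ler_nat leq_maxr.
have d0 : 0 <= d%:R :> R by []. have e0 : 0 <= e%:R :> R by [].
by rewrite -natr1 ltr_norml; apply/andP; split; lra.
Qed.

(** If b lies in the cell J, then the cells 0, ..., J - 1 lie inside [0, b) and the
cells J + 1, ..., p inside [b, 1).  Rounding to cells costs one cell on each
side, which is compensated by an interval of n cells containing n + 1 - S windows
and not just n - S. *)
Lemma count_lt_deviation_le (R : realType) (x : nat -> R) (N S p : nat)
    (M E B : R) :
    (forall n : nat, (0 < n)%N -> 0 <= x n < 1) ->
    (0 < S)%N -> (2 * S <= p.+1)%N -> 0 < M <= p.+1%:R -> 0 <= B ->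
    (forall s, (0 < s <= S)%N ->
      (close_pairs x N (s%:R / M))%:R <= 2 * s%:R * E) ->
    p.+1%:R * (N%:R * S%:R + S%:R * (S%:R + 1) * E) - (N%:R * S%:R) ^+ 2
      <= (S%:R * B) ^+ 2 ->
  forall b, 0 <= b <= 1 ->
    `|(count_lt x N b)%:R - N%:R * b| <= N%:R * S%:R / p.+1%:R + B.
Proof.
move=> x01 S0 leSp /andP[M0 MP] B0 Hpairs Hnum b /andP[b0 b1].
have P0 : 0 < p.+1%:R :> R by rewrite ltr0n.
pose c (i : 'I_N) := cell p (x i.+1).
have leSp1 : (S <= p.+1)%N by lia.
have Hvar : p.+1%:R * \sum_j ((occupancy S c j)%:R -
    (#|'I_N| * S)%:R / p.+1%:R) ^+ 2 <= (S%:R * B) ^+ 2.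
  rewrite occupancy_variance // card_ord; apply: le_trans Hnum.
  rewrite mulrBr mulrCA divff ?gt_eqF // mulr1 natrM lerD2r ler_wpM2l //.
  pose D (i i' : 'I_N) : pred nat :=
    fun m => dist_int (x i.+1 - x i'.+1) < m.+1%:R / M.
  have close i i' (j : 'I_p.+1) : i != i' -> ((c i - j)%R < S)%N ->
      ((c i' - j)%R < S)%N -> D i i' (maxn (c i - j)%R (c i' - j)%R).
    move=> _ _ _.
    apply: lt_le_trans (dist_int_lt_of_offsets j (x01 _ _) (x01 _ _)) _ => //.
    by rewrite ler_wpM2l // lef_pV2.
  have := sum_occupancy_sqr_le leSp close.
  rewrite -(ler_nat R) card_ord => /le_trans; apply.
  rewrite natrD natrM lerD2l natr_sum.
  apply: (@le_trans _ _ (\sum_(m < S) 2 * m.+1%:R * E)).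
    by apply: ler_sum => m _; apply: Hpairs; rewrite ltnS /=.
  rewrite -mulr_suml -mulr_sumr -natr_sum.
  have -> : (2 * (\sum_(i < S) i.+1)%:R)%R = S%:R * (S%:R + 1) :> R.
    elim: (S) => [|n IHn]; first by rewrite big_ord0 mulr0 mul0r.
    by rewrite big_ord_recr /= natrD mulrDr IHn -!natr1; ring.
  by [].
have cP i : (c i)%:R <= p.+1%:R * x i.+1 < (c i)%:R + 1 by exact/cell_itv/x01.
pose J := Num.trunc (p.+1%:R * b).
have pb0 : 0 <= p.+1%:R * b by rewrite mulr_ge0.
have /andP[J1 J2] : J%:R <= p.+1%:R * b < J.+1%:R by exact: truncn_itv.
have JP : (J <= p.+1)%N.
  by rewrite -(ler_nat R) (le_trans J1) // ger_pMr.
have cells_ge (a e : nat) : (e <= p.+1)%N ->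
    (e%:R + 1 - a%:R - S%:R) * (N%:R / p.+1%:R) - B
      <= #|[pred i | (a <= c i < e)%N]|%:R.
  move=> lee; have := card_cells_itv_ge (c := c) a _ lee B0 Hvar.
  by rewrite card_ord S0 leSp1; exact.
have lower : (#|[pred i | (0 <= c i < J)%N]| <= count_lt x N b)%N.
  apply/subset_leq_card/fintype.subsetP => i; rewrite inE /= => ciJ.
  change (x i.+1 \in `[0, b[); rewrite in_itv /=.
  have /andP[-> _] := x01 i.+1 isT; rewrite /=.
  have /andP[_ ci2] := cP i.
  rewrite -(ltr_pM2l P0); apply: lt_le_trans ci2 _; apply: le_trans J1.
  by rewrite natr1 ler_nat.
have upper : (#|[pred i | (J.+1 <= c i < p.+1)%N]| + count_lt x N b <= N)%N.
  rewrite -[X in (_ <= X)%N]card_ord -(cardC [pred i : 'I_N | x i.+1 \in `[0, b[]).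
  rewrite addnC leq_add2l; apply/subset_leq_card/fintype.subsetP => i.
  rewrite inE => /andP[Jci _].
  change (x i.+1 \notin `[0, b[); rewrite in_itv /= negb_and -leNgt.
  apply/orP; right; have /andP[ci1 _] := cP i.
  rewrite -(ler_pM2l P0); apply: le_trans ci1; apply: le_trans (ltW J2) _.
  by rewrite ler_nat.
have := cells_ge 0%N J JP; have := cells_ge J.+1 p.+1 (leqnn _).
move: lower upper; rewrite -2!(ler_nat R) natrD.
set n3 : R := (count_lt x N b)%:R.
set n1 : R := #|_|%:R; set n2 : R := #|_|%:R.
move=> lower upper lo1 lo2.
set r : R := N%:R / p.+1%:R in lo1 lo2.
have r0 : 0 <= r by rewrite divr_ge0.
have rP : p.+1%:R * r = N%:R by rewrite mulrCA divff ?gt_eqF // mulr1.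
have -> : N%:R * S%:R / p.+1%:R = S%:R * r by rewrite /r mulrAC mulrC.
have -> : N%:R * b = p.+1%:R * b * r by rewrite mulrAC rP.
rewrite -natr1 in J2 lo1.
have k1 : (p.+1%:R * b - S%:R) * r <= (J%:R + 1 - 0%:R - S%:R) * r.
  by rewrite ler_wpM2r // subr0; lra.
have k2 : (p.+1%:R - p.+1%:R * b - S%:R) * r
    <= (p.+1%:R + 1 - (J%:R + 1) - S%:R) * r.
  by rewrite ler_wpM2r //; lra.
rewrite ler_norml; apply/andP; split; lra.
Qed.

(** * The pair correlation hypothesis and the choice of parameters *)

Lemma close_pairs_le (R : realType) (x : nat -> R) (alpha : R) (K N s : nat)
    (r : R) : (0 < s <= K)%N -> max_pair_deviation x alpha K N < r ->
  (close_pairs x N (s%:R / N%:R `^ alpha))%:R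
    <= 2 * s%:R * (N%:R `^ (2 - alpha) + r).
Proof.
move=> /andP[s0 sK] lt_r.
have s2 : 0 < 2 * s%:R :> R by rewrite mulr_gt0 // ltr0n.
have : `|(2 * s%:R)^-1 * (close_pairs x N (s%:R / N%:R `^ alpha))%:R
      - N%:R `^ (2 - alpha)| < r.
  apply: le_lt_trans lt_r; rewrite /max_pair_deviation.
  pose f t : R := `|(2 * t%:R)^-1 * (close_pairs x N (t%:R / N%:R `^ alpha))%:R
      - N%:R `^ (2 - alpha)|.
  by apply: (le_bigmax_seq 0 s xpredT f) => //; rewrite mem_index_iota s0.
rewrite ltr_norml => /andP[_ /ltW].
by rewrite lerBlDl ler_pdivrMl.
Qed.

(** The bound for P * variance for windows of S cells.  After dividing by S, the
second-moment main term P (S + 1) N^2 / M exceeds the squared mean S N^2 by at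
most 2 N^2, the diagonal P N adds at most 2 N^2, and the F term at most 4 S Z^2.
The total is within the available 16 S Z^2 because
S Z^2 >= (a^4 / 4) (N / a)^2 >= N^2. *)
Lemma variance_numerics (R : realFieldType) (N S P M a F Z : R) :
    2 <= a -> M = a ^+ 5 -> M <= N -> M <= P <= M + 1 ->
    1 <= S -> S <= a ^+ 4 <= 4 * S -> 0 < F ->
    N / a <= Z -> M * F <= Z ^+ 2 ->
  P * (N * S + S * (S + 1) * (N ^+ 2 / M + F)) - (N * S) ^+ 2
    <= (S * (4 * Z)) ^+ 2.
Proof.
move=> a2 ME MN /andP[MP PM] S1 /andP[Sa aS] F0 XZ FZ.
have a0 : 0 < a by lra.
have M0 : 0 < M by rewrite ME exprn_gt0.
have N0 : 0 < N by lra.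
have aM : 2 * a ^+ 4 <= M by rewrite ME (exprS a 4) ler_pM2r ?exprn_gt0.
have a4 : 16 <= a ^+ 4.
  have -> : 16 = 2 ^+ 4 :> R by rewrite -!natrX.
  by rewrite lerXn2r ?nnegrE //; lra.
have t1 : P * N <= 2 * N ^+ 2.
  by rewrite expr2 mulrA ler_pM2r //; lra.
have t2 : P * ((S + 1) * (N ^+ 2 / M)) <= (S + 2) * N ^+ 2.
  have -> : P * ((S + 1) * (N ^+ 2 / M)) = (P * (S + 1) / M) * N ^+ 2 by ring.
  rewrite ler_pM2r ?exprn_gt0 // ler_pdivrMr //.
  apply: (@le_trans _ _ ((M + 1) * (S + 1))); first by rewrite ler_pM2r; lra.
  lra.
have t3 : P * ((S + 1) * F) <= 4 * S * Z ^+ 2.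
  apply: (@le_trans _ _ (2 * M * (2 * S * F))).
    apply: ler_pM; [lra | | lra | ].
      by rewrite mulr_ge0 //; lra.
    by rewrite ler_pM2r //; lra.
  have -> : 2 * M * (2 * S * F) = 4 * S * (M * F) by ring.
  by rewrite ler_pM2l //; lra.
have t4 : N ^+ 2 <= S * Z ^+ 2.
  have NaZ : N <= a * Z by rewrite mulrC -ler_pdivrMr.
  have Z0 : 0 <= Z by apply: le_trans XZ; rewrite divr_ge0; lra.
  have : N ^+ 2 <= a ^+ 2 * Z ^+ 2.
    by rewrite -exprMn lerXn2r ?nnegrE //; lra.
  move=> /le_trans; apply; rewrite ler_wpM2r ?sqr_ge0 //.
  have a22 : 4 <= a ^+ 2.
    have -> : 4 = 2 ^+ 2 :> R by rewrite -!natrX.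
    by rewrite lerXn2r ?nnegrE //; lra.
  have : 4 * a ^+ 2 <= a ^+ 4.
    have -> : a ^+ 4 = a ^+ 2 * a ^+ 2 by ring.
    by rewrite ler_pM2r //; lra.
  lra.
have -> : P * (N * S + S * (S + 1) * (N ^+ 2 / M + F)) - (N * S) ^+ 2 =
  S * (P * N + P * ((S + 1) * (N ^+ 2 / M)) + P * ((S + 1) * F) - S * N ^+ 2)
  by ring.
have -> : (S * (4 * Z)) ^+ 2 = S * (16 * (S * Z ^+ 2)) by ring.
have N2 := sqr_ge0 N.
rewrite ler_pM2l; lra.
Qed.

Theorem theorem1p4 (R : realType) (x : nat -> R) (alpha : R)
    (F : nat -> nat -> R)
    (x01 : forall n : nat, (0 < n)%N -> 0 <= x n < 1)
    (alpha01 : 0 < alpha <= 1)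
    (F_mono : forall K1 K2 N : nat,
      (0 < N)%N -> (0 < K1)%N -> (K1 <= K2)%N -> F K1 N <= F K2 N)
    (F_bound : forall N K : nat,
      (0 < N)%N -> (0 < K)%N -> K%:R <= N%:R / 2 :> R ->
      max_pair_deviation x alpha K N < F K N) :
  exists2 N0 : nat, (0 < N0)%N &
    forall N K : nat, (N0 <= N)%N -> (0 < K)%N ->
      2^-1 * N%:R `^ (2 / 5 * alpha) <= K%:R <= N%:R `^ (2 / 5 * alpha) ->
      N%:R * star_discrepancy x N
        <= 5 * Num.max (N%:R `^ (1 - 1 / 5 * alpha))
                       (Num.sqrt (N%:R `^ alpha * F (K ^ 2)%N N)).
Proof.
have /andP[al0 al1] := alpha01.
(* A is the value of N at which a = N ^ (alpha / 5) reaches 2. *)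
pose A : R := 2 `^ (5 / alpha).
exists (Num.trunc A).+1 => // N K N0N K0 /andP[Klo Khi].
have AN : A <= N%:R.
  by rewrite (le_trans (ltW (truncnS_gt A))) // ler_nat.
have N1 : (0 < N)%N by apply: leq_trans N0N.
have NR1 : 1 <= N%:R :> R by rewrite ler1n.
have NR0 : 0 < N%:R :> R by rewrite ltr0n.
pose a : R := N%:R `^ (alpha / 5).
have aX (n : nat) : N%:R `^ (alpha / 5 * n%:R) = a ^+ n.
  by rewrite powRrM powR_mulrn // powR_ge0.
have a0 : 0 < a by rewrite powR_gt0.
have a2 : 2 <= a.
  have -> : 2 = A `^ (alpha / 5) :> R.
    rewrite /A -powRrM (_ : 5 / alpha * (alpha / 5) = 1) ?powRr1 //.
    by field; rewrite gt_eqF.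
  by rewrite ge0_ler_powR ?nnegrE ?powR_ge0 // divr_ge0 // ltW.
have ME : N%:R `^ alpha = a ^+ 5 by rewrite -aX; congr powR; field.
have a2E : N%:R `^ (2 / 5 * alpha) = a ^+ 2 by rewrite -aX; congr powR; field.
have powRB (r t : R) : N%:R `^ (r - t) = N%:R `^ r / N%:R `^ t.
  by rewrite powRD ?powRN //; apply/implyP => _; rewrite gt_eqF.
have XE : N%:R `^ (1 - 1 / 5 * alpha) = N%:R / a.
  by rewrite powRB powRr1 //; congr (_ / _); congr powR; field.
have EE : N%:R `^ (2 - alpha) = N%:R ^+ 2 / N%:R `^ alpha.
  by rewrite powRB powR_mulrn.
rewrite a2E in Klo Khi.
pose M : R := N%:R `^ alpha; rewrite -/M in ME EE.
have MN : M <= N%:R by rewrite -[leRHS]powRr1 // ler_powR.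
pose S := (K ^ 2)%N.
have S0 : (0 < S)%N by rewrite expn_gt0 K0.
have SR1 : 1 <= S%:R :> R by rewrite ler1n.
have SE : S%:R = K%:R ^+ 2 :> R by rewrite natrX.
have KR0 : 0 <= K%:R :> R by [].
have Sa : S%:R <= a ^+ 4 by rewrite SE (exprM a 2 2) lerXn2r ?nnegrE //; lra.
have aS : a ^+ 4 <= 4 * S%:R.
  have -> : 4 * S%:R = (2 * K%:R) ^+ 2 :> R by rewrite SE; ring.
  by rewrite (exprM a 2 2) lerXn2r ?nnegrE //; lra.
have aM : 2 * a ^+ 4 <= M by rewrite ME (exprS a 4) ler_pM2r ?exprn_gt0.
have M0 : 0 < M by rewrite ME exprn_gt0.
have devF : max_pair_deviation x alpha S N < F S N by apply: F_bound => //; lra.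
have F0 : 0 < F S N.
  apply: le_lt_trans devF; rewrite /max_pair_deviation.
  by elim/big_ind: _ => // u v u0 v0; rewrite le_max u0.
rewrite XE -/M -/S.
set Z := Num.max _ _.
have XZ : N%:R / a <= Z by rewrite le_max lexx.
have Z0 : 0 < Z by apply: lt_le_trans XZ; rewrite divr_gt0.
have FZ : M * F S N <= Z ^+ 2.
  have MF0 : 0 <= M * F S N by rewrite ltW // mulr_gt0.
  rewrite -(sqr_sqrtr MF0) lerXn2r ?nnegrE ?sqrtr_ge0 ?(ltW Z0) //.
  by rewrite le_max lexx orbT.
(* p + 1 cells, with p the integer part of M, give M < p + 1 <= M + 1. *)
pose p := Num.trunc M.
have /andP[pM Mp] : p%:R <= M < p.+1%:R by apply: truncn_itv; lra.
have pM1 : p.+1%:R <= M + 1 by rewrite -natr1; lra.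
have leSp : (2 * S <= p.+1)%N by rewrite -(ler_nat R) natrM; lra.
have dev b : 0 <= b <= 1 ->
    `|(count_lt x N b)%:R - N%:R * b| <= N%:R * S%:R / p.+1%:R + 4 * Z.
  apply: (count_lt_deviation_le (M := M) (E := N%:R ^+ 2 / M + F S N)) => //.
  - by rewrite M0 ltW.
  - by lra.
  - by move=> s sS; rewrite -EE; apply: close_pairs_le devF.
  - apply: (@variance_numerics _ _ _ _ M a) => //.
      by rewrite ltW.
    by rewrite Sa.
have window : N%:R * S%:R / p.+1%:R <= Z.
  apply: le_trans XZ; rewrite -mulrA ler_pM2l //.
  rewrite ler_pdivrMr ?ltr0n // mulrC ler_pdivlMr //.
  apply: le_trans (ltW Mp); rewrite ME (exprSr a 4).
  by rewrite ler_pM2r.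
rewrite mulrC -ler_pdivlMr //; apply: ge_sup.
  by exists `|N%:R^-1 * (count_lt x N 0)%:R - 0|, 0; rewrite //= lexx ler01.
move=> _ [b /= b01 <-].
rewrite ler_pdivlMr // -[X in _ * X](gtr0_norm NR0) -normrM mulrBl mulrAC.
rewrite mulVf ?gt_eqF // mul1r (mulrC b); apply: le_trans (dev b b01) _.
by apply: le_trans (lerD window (lexx _)) _; lra.
Qed.
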